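(* Let $1<p<\infty$, let $\mu_0,\mu_1$ be positive Borel measures supported on the intervals $\Delta_0\subset\mathbb{R}$ and $\Delta_1\subset\mathbb{R}$ respectively, where $\Delta_0$ does not reduce to a point, and let $\|f\|_{S,p}=\left(\int_{\Delta_0}|f|^p\,d\mu_0+\int_{\Delta_1}|f'|^p\,d\mu_1\right)^{1/p}$ for polynomials $f$. Let $L_n$ be a monic polynomial of degree $n$. Then $L_n$ is the $n$th monic extremal polynomial with respect to $\|\cdot\|_{S,p}$ if and only if $$\int_{\Delta_0}Q(x)\,\operatorname{sgn}(L_n(x))\,|L_n(x)|^{p-1}\,d\mu_0(x)+\int_{\Delta_1}Q'(x)\,\operatorname{sgn}(L_n'(x))\,|L_n'(x)|^{p-1}\,d\mu_1(x)=0$$ for every polynomial $Q\in\mathbb{P}_{n-1}$.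
   Context: $\mathbb{P}_{n}$ is the space of polynomials with complex coefficients of degree at most $n$. $\operatorname{sgn}(y)=y/|y|$ if $y\ne0$ and $\operatorname{sgn}(0)=0$. ''Supported on $\Delta_k$'' means that the support of $\mu_k$ is contained in $\Delta_k$. Standing assumptions: the support of $\mu_0$ is an infinite set, and all polynomials belong to $L^p(\mu_0)$ and $L^p(\mu_1)$. The $n$th monic extremal polynomial with respect to $\|\cdot\|_{S,p}$ is the unique monic polynomial of exact degree $n$ that minimizes $\|Q\|_{S,p}$ among all monic polynomials $Q$ of degree $n$. *)

(* Defs.v *)
(* MathComp-Analysis; complex numbers R[i] over R : realType come from
   mathcomp-real-closed. *)
From HB Require Import structures.
From mathcomp Require Import all_boot all_order all_algebra.
From mathcomp Require Import all_classical all_reals all_analysis.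
From mathcomp Require Import complex.

Set Implicit Arguments.
Unset Strict Implicit.
Unset Printing Implicit Defensive.

Import Order.TTheory GRing.Theory Num.Theory.
Import numFieldNormedType.Exports.

Local Open Scope classical_set_scope.
Local Open Scope ring_scope.
Local Open Scope complex_scope.

Definition measure_support (R : realType)
    (mu : {measure set (measurableTypeR R) -> \bar R}) : set R :=
  [set x | forall U : set R, open U -> U x -> (0 < mu U)%E].

(* Num.sg is not z / |z| on R[i]: it equals -1 off the nonnegative reals. *)
Definition csgn (R : realType) (z : R[i]) : R[i] :=
  if z == 0 then 0 else z / `|z|.

(* Meaningful when both parts are integrable: Rintegral is total, with
   junk values otherwise. *)
Definition cintegral (R : realType)
    (mu : {measure set (measurableTypeR R) -> \bar R})
    (D : set R) (f : R -> R[i]) : R[i] :=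
  Rintegral mu D (fun x => complex.Re (f x))
    +i* Rintegral mu D (fun x => complex.Im (f x)).

(* Normc.normc is the R-valued modulus, whereas `|z| lies in R[i]. *)
Definition complex_Lp (R : realType)
    (mu : {measure set (measurableTypeR R) -> \bar R}) (p : R)
    (f : R -> R[i]) : Prop :=
  [/\ measurable_fun [set: measurableTypeR R] (fun x => complex.Re (f x)),
      measurable_fun [set: measurableTypeR R] (fun x => complex.Im (f x)) &
      finite_norm mu p%:E (fun x => Normc.normc (f x))].

Definition sobolev_norm (R : realType)
    (mu0 mu1 : {measure set (measurableTypeR R) -> \bar R})
    (D0 D1 : set R) (p : R) (f : {poly R[i]}) : \bar R :=
  poweR (\int[mu0]_(x in D0) (Normc.normc f.[x%:C] `^ p)%:E
         + \int[mu1]_(x in D1) (Normc.normc (f^`()).[x%:C] `^ p)%:E)%E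
        p^-1.

Definition monic_of_degree (R : realType) (n : nat) (Q : {poly R[i]}) : Prop :=
  Q \is monic /\ size Q = n.+1.

Definition is_monic_minimizer (R : realType)
    (N : {poly R[i]} -> \bar R) (n : nat) (L : {poly R[i]}) : Prop :=
  monic_of_degree n L /\
  forall Q : {poly R[i]}, monic_of_degree n Q -> (N L <= N Q)%E.

Definition is_monic_extremal (R : realType)
    (N : {poly R[i]} -> \bar R) (n : nat) (L : {poly R[i]}) : Prop :=
  unique (is_monic_minimizer N n) L.

(* Main.v *)
(* For complex z and w, write B(z, w) = |z|^(p-2) Re(conj z * w). Young's
   inequality and Cauchy-Schwarz give
   |w|^p >= |z|^p + p B(z, w - z), strictly unless z = w.
   Integrating, and writing Phi for the p-th power of the Sobolev norm and
   S(L, Q) for the sum of the integrals of B(L, Q) and B(L', Q'), we get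
   Phi(Q) >= Phi(L) + p S(L, Q - L).  If S(L, .) vanishes in degree < n, L is
   therefore a minimizer; equality forces Q = L almost everywhere on D0, hence
   Q = L, because the infinite support of mu0 contains a point interior to D0
   at which Q - L would not vanish.  Conversely, if L is a minimizer, the same
   inequality based at L + tQ gives S(L + tQ, Q) >= 0 for t > 0, and dominated
   convergence as t -> 0 gives S(L, Q) >= 0 for both Q and -Q.
   The orthogonality condition of the theorem is S(L, .) = 0 after conjugating
   the coefficients of Q, since polynomials are evaluated at real points. *)
Require Import Defs.
From HB Require Import structures.
From mathcomp Require Import all_boot all_order all_algebra.
From mathcomp Require Import all_classical all_reals all_analysis.
From mathcomp Require Import complex.
From mathcomp Require Import measurable_realfun ring lra.

Set Implicit Arguments.
Unset Strict Implicit.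
Unset Printing Implicit Defensive.

Import Order.TTheory GRing.Theory Num.Theory.
Import numFieldNormedType.Exports.

Local Open Scope classical_set_scope.
Local Open Scope ring_scope.
Local Open Scope complex_scope.

(** * Scalar convexity inequalities for exponentials and real powers *)

(** The tangent to [expR] at the weighted mean [c] lies strictly below the graph at [x] and at [y],
    and its values there average to [expR c]. *)
Lemma weighted_expR_gt (R : realType) (t x y : R) : 0 < t < 1 -> x != y ->
  expR (t * x + (1 - t) * y) < t * expR x + (1 - t) * expR y.
Proof.
move=> /andP[t0 t1] xy; set c := t * x + (1 - t) * y.
have h u : u != c -> expR c * (1 + (u - c)) < expR u.
  move=> uc; rewrite -[X in _ < expR X](subrKC c u) [ltRHS]expRD ltr_pM2l ?expR_gt0//.
  by apply: expR_gt1Dx; rewrite subr_eq0.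
have xc : x != c.
  rewrite -subr_eq0 (_ : x - c = (1 - t) * (x - y)); last by rewrite /c; ring.
  by rewrite mulf_neq0// subr_eq0// gt_eqF.
have yc : y != c.
  rewrite -subr_eq0 (_ : y - c = - (t * (x - y))); last by rewrite /c; ring.
  by rewrite oppr_eq0 mulf_neq0// ?subr_eq0// gt_eqF.
have -> : expR c = t * (expR c * (1 + (x - c))) + (1 - t) * (expR c * (1 + (y - c))).
  by rewrite /c; ring.
by apply: ltrD; rewrite ltr_pM2l ?h// subr_gt0.
Qed.

(** For positive [r] and [s] this is strict convexity of [expR] at [p * ln s] and [p * ln r], with
    weights [p^-1] and [1 - p^-1]. Zero arguments are split off because [ln 0] is only a default
    value. *)
Lemma young_powR_lt (R : realType) (p r s : R) : 1 < p -> 0 <= r -> 0 <= s ->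
  r != s -> p * (r `^ (p - 1) * s) < s `^ p + (p - 1) * r `^ p.
Proof.
move=> p1; have p0 : 0 < p by apply: lt_trans p1.
have pn0 : p != 0 by rewrite gt_eqF.
have q0 : 0 < p - 1 by rewrite subr_gt0.
rewrite !le_eqVlt => /orP[/eqP<-|r0].
  move=> /orP[/eqP<-|s0 _]; first by rewrite eqxx.
  by rewrite !powR0 ?gt_eqF// mul0r !mulr0 addr0 powR_gt0.
move=> /orP[/eqP<- _|s0 rs].
  by rewrite powR0// !mulr0 add0r mulr_gt0// powR_gt0.
have := @weighted_expR_gt R p^-1 (p * ln s) (p * ln r).
rewrite invr_gt0 p0 invf_lt1// p1 => /(_ isT).
have -> : p * ln s != p * ln r.
  by apply: contra_neq rs => /(mulfI pn0)/ln_inj-> //.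
move=> /(_ isT).
rewrite (_ : _ + _ = (p - 1) * ln r + ln s); last by field.
rewrite expRD lnK// /powR !gt_eqF//.
rewrite -(ltr_pM2l p0).
by rewrite mulrDr !mulrA mulfV// mul1r mulrBr mulr1 mulfV.
Qed.

Lemma powR_add_le (R : realType) (p r s : R) : 0 <= p -> 0 <= r -> 0 <= s ->
  (r + s) `^ p <= 2 `^ p * (r `^ p + s `^ p).
Proof.
move=> p0; wlog rs : r s / r <= s => [H|r0 s0].
  have [rs|/ltW sr] := leP r s; first exact: H.
  by move=> r0 s0; rewrite addrC [X in _ * X]addrC; exact: H.
apply: (@le_trans _ _ ((2 * s) `^ p)).
  by apply: ge0_ler_powR; rewrite ?nnegrE ?addr_ge0 ?mulr_ge0//; lra.
by rewrite powRM// ler_wpM2l ?powR_ge0// lerDr powR_ge0.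
Qed.

(** * The derivative of the p-th power of the modulus on the complex plane *)

Section pairing.
Variables (R : realType) (p : R).
Hypothesis p1 : 1 < p.
Implicit Types z w : R[i].

Let p0 : 0 < p. Proof. exact: lt_trans p1. Qed.
Let q0 : 0 < p - 1. Proof. by rewrite subr_gt0. Qed.

Definition dotc z w : R :=
  complex.Re z * complex.Re w + complex.Im z * complex.Im w.

(* The Gateaux derivative of |.|^p at z along w, divided by p.  At z = 0 and
   p = 2 the power is 0 `^ 0 = 1, but the dot product vanishes. *)
Definition powR_pairing z w : R := dotc z w * Normc.normc z `^ (p - 2).

Lemma normc_ge0 z : 0 <= Normc.normc z.
Proof. by case: z => a b; exact: sqrtr_ge0. Qed.

Lemma normc_eq0 z : (Normc.normc z == 0) = (z == 0).
Proof.
by apply/eqP/eqP => [/Normc.eq0_normc//|->]; rewrite Normc.normc0.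
Qed.

Lemma sqr_normc z : Normc.normc z ^+ 2 = dotc z z.
Proof.
by case: z => a b; rewrite /= sqr_sqrtr /dotc/= -?expr2// addr_ge0 ?sqr_ge0.
Qed.

Lemma dotc_le z w : `|dotc z w| <= Normc.normc z * Normc.normc w.
Proof.
rewrite -(@ler_pXn2r _ 2)// ?nnegrE ?mulr_ge0 ?normc_ge0//.
rewrite exprMn !sqr_normc real_normK ?num_real// /dotc.
case: z w => [a b] [c d] /=; rewrite -subr_ge0.
by have := sqr_ge0 (a * d - b * c); lra.
Qed.

(** Equality case of Cauchy-Schwarz: the squared modulus of [z - w] expands to zero. *)
Lemma dotc_eq z w : Normc.normc z = Normc.normc w ->
  dotc z w = Normc.normc z * Normc.normc w -> z = w.
Proof.
move=> zw; rewrite -zw -expr2 => dzw.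
apply/eqP; rewrite -subr_eq0 -normc_eq0 -[_ == 0](@expf_eq0 _ _ 2).
rewrite sqr_normc; apply/eqP.
have := sqr_normc w; rewrite -zw => ww; have := sqr_normc z => zz.
have -> : dotc (z - w) (z - w) = dotc z z - 2 * dotc z w + dotc w w.
  by clear; case: z w => [a b] [c d]; rewrite /dotc/=; ring.
by rewrite -ww -zz dzw; ring.
Qed.

Lemma powR_normcM z :
  Normc.normc z * Normc.normc z `^ (p - 2) = Normc.normc z `^ (p - 1).
Proof.
rewrite -{1}(powRr1 (normc_ge0 z)) -powRD.
  by congr powR; ring.
(* At base zero [powRD] asks for a nonzero sum of exponents; the sum is [p - 1]. *)
by rewrite addrCA (_ : 1 - 2 = - 1 :> R); [rewrite gt_eqF | lra].
Qed.

Lemma powR_normcM1 z :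
  Normc.normc z * Normc.normc z `^ (p - 1) = Normc.normc z `^ p.
Proof.
rewrite -{1}(powRr1 (normc_ge0 z)) -powRD.
  by congr powR; ring.
by rewrite addrC subrK gt_eqF.
Qed.

Lemma powR_pairing_le z w :
  `|powR_pairing z w| <= Normc.normc z `^ (p - 1) * Normc.normc w.
Proof.
rewrite normrM (ger0_norm (powR_ge0 _ _)) -powR_normcM mulrAC.
by rewrite ler_wpM2r ?powR_ge0 ?dotc_le.
Qed.

(** The product |z|^(p-1) |w| is at most the p-th power of the larger modulus. This bound makes the
    pairings integrable. *)
Lemma powR_pairing_bound z w :
  `|powR_pairing z w| <= Normc.normc z `^ p + Normc.normc w `^ p.
Proof.
apply: le_trans (powR_pairing_le z w) _.
set r := Normc.normc z; set s := Normc.normc w.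
have r0 : 0 <= r := normc_ge0 z; have s0 : 0 <= s := normc_ge0 w.
have [rs|/ltW sr] := leP r s.
  apply: (@le_trans _ _ (s `^ p)); last by rewrite lerDr powR_ge0.
  rewrite -powR_normcM1 mulrC ler_wpM2l//.
  by apply: ge0_ler_powR => //; exact: ltW.
apply: (@le_trans _ _ (r `^ p)); last by rewrite lerDl powR_ge0.
by rewrite -powR_normcM1 mulrC ler_wpM2r// powR_ge0.
Qed.

Let pairingzz z w : powR_pairing z (w - z) =
  powR_pairing z w - Normc.normc z `^ p.
Proof.
rewrite -powR_normcM1 -powR_normcM mulrA -expr2 sqr_normc /powR_pairing -mulrBl.
by congr (_ * _); clear; case: z w => [a b] [c d]; rewrite /dotc/=; ring.
Qed.

(** Strictness has two sources: Young's inequality when the moduli differ, and the equality case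
    [dotc_eq] of Cauchy-Schwarz when they agree. *)
Lemma powR_normc_convex_lt z w : z != w ->
  Normc.normc z `^ p + p * powR_pairing z (w - z) < Normc.normc w `^ p.
Proof.
move=> zw; rewrite pairingzz mulrBr.
have pw := le_trans (ler_norm _) (powR_pairing_le z w).
have [rs|rs] := eqVneq (Normc.normc z) (Normc.normc w); last first.
  have Y := young_powR_lt p1 (normc_ge0 z) (normc_ge0 w) rs.
  have : p * powR_pairing z w <= p * (Normc.normc z `^ (p - 1) * Normc.normc w).
    by rewrite ler_pM2l.
  lra.
(* This makes |z|^(p-2) positive, so that it can be cancelled below. *)
have z0 : z != 0.
  by apply: contra_neq zw => z_0; move: rs;
  rewrite z_0 Normc.normc0 => rs; apply/esym/Normc.eq0_normc.
suff : p * powR_pairing z w < p * Normc.normc z `^ p by rewrite rs; lra.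
rewrite ltr_pM2l// -powR_normcM1 -powR_normcM mulrA.
rewrite ltr_pM2r; last by rewrite powR_gt0// lt_neqAle normc_ge0 eq_sym normc_eq0 z0.
rewrite lt_neqAle {4}rs (le_trans (ler_norm _) (dotc_le z w)) ?andbT//.
by apply: contra_neq zw => h; apply: dotc_eq; rewrite -?rs.
Qed.

Lemma powR_normc_convex z w :
  Normc.normc z `^ p + p * powR_pairing z (w - z) <= Normc.normc w `^ p.
Proof.
have [->|zw] := eqVneq z w; last exact/ltW/powR_normc_convex_lt.
rewrite /powR_pairing subrr (_ : dotc w 0 = 0) ?mul0r ?mulr0 ?addr0//.
by rewrite /dotc/= !mulr0 addr0.
Qed.

Lemma csgn_powR z : csgn z * (Normc.normc z `^ (p - 1))%:C =
  z * (Normc.normc z `^ (p - 2))%:C.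
Proof.
rewrite /csgn; case: eqP => [->|/eqP z0]; first by rewrite !mul0r.
have nz : (Normc.normc z)%:C != 0 by rewrite (inj_eq (@complexI R)) normc_eq0.
rewrite -powR_normcM rmorphM/= (_ : `|z| = (Normc.normc z)%:C).
  by rewrite mulrA divfK.
by case: (z).
Qed.

Lemma Re_csgn_pairing z w :
  complex.Re (conjc w * csgn z * (Normc.normc z `^ (p - 1))%:C) =
  powR_pairing z w.
Proof.
rewrite -mulrA csgn_powR mulrA /powR_pairing /dotc.
by case: z w => [a b] [c d]; simpc => /=; ring.
Qed.

(** Away from [z = 0] all factors are continuous. At [z = 0] the factor |z|^(p-2) may blow up when p
    < 2, but homogeneity turns the pairing of tw with w into t^(p-1) times that of w with w, which
    tends to 0. *)
Lemma cvg_powR_pairing z w :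
  powR_pairing (z + (k.+1%:R^-1)%:C * w) w @[k --> \oo] --> powR_pairing z w.
Proof.
have cvt : (k.+1%:R^-1 : R) @[k --> \oo] --> (0:R) by exact: cvg_harmonic.
have [->|z0] := eqVneq z 0.
  have -> : powR_pairing 0 w = 0 * powR_pairing w w.
    by rewrite /powR_pairing /dotc/= !mul0r addr0 mul0r.
  rewrite (_ : (fun k => _) = fun k => (k.+1%:R^-1 : R) `^ (p - 1) * powR_pairing w w).
    apply: cvgMr_tmp.
    by apply: (cvg_at_rightP _ _ _).1 (powR_cvg0 q0) _ _; split=> // k; rewrite invr_gt0.
  apply/funext => k; rewrite /powR_pairing /dotc add0r.
  have t0 : 0 < k.+1%:R^-1 :> R by rewrite invr_gt0.
  set t : R := k.+1%:R^-1 in t0 *.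
  rewrite Normc.normcM powRM ?normc_ge0// (_ : Normc.normc t%:C = t); last first.
    by rewrite /= expr0n addr0 sqrtr_sqr gtr0_norm.
  rewrite (_ : p - 1 = 1 + (p - 2)); last by ring.
  rewrite (@powRD _ t 1) ?(gt_eqF t0) ?implybT// powRr1 ?ltW//.
  by clear; case: w => [a b]; simpc => /=; ring.
have nz0 : 0 < Normc.normc z by rewrite lt_neqAle eq_sym normc_eq0 z0 normc_ge0.
have cpow : {for Normc.normc z, continuous (fun r : R => r `^ (p - 2))}.
  apply/differentiable_continuous/derivable1_diffP/derivable_powR.
  by rewrite in_itv/= nz0.
have cRe : complex.Re z + k.+1%:R^-1 * complex.Re w @[k --> \oo] --> complex.Re z.
  rewrite -[X in _ --> X]addr0 -(mul0r (complex.Re w)).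
  by apply: cvgD; [exact: cvg_cst | exact: cvgMr_tmp].
have cIm : complex.Im z + k.+1%:R^-1 * complex.Im w @[k --> \oo] --> complex.Im z.
  rewrite -[X in _ --> X]addr0 -(mul0r (complex.Im w)).
  by apply: cvgD; [exact: cvg_cst | exact: cvgMr_tmp].
have E k : z + (k.+1%:R^-1)%:C * w =
    (complex.Re z + k.+1%:R^-1 * complex.Re w) +i*
    (complex.Im z + k.+1%:R^-1 * complex.Im w).
  by clear; case: z w => [a b] [c d]; simpc.
under eq_fun do rewrite E.
apply: cvgM.
  by apply: cvgD; exact: cvgMr_tmp.
suff cn : Normc.normc ((complex.Re z + k.+1%:R^-1 * complex.Re w) +i*
    (complex.Im z + k.+1%:R^-1 * complex.Im w)) @[k --> \oo] --> Normc.normc z.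
  exact: (continuous_cvg _ cpow cn).
have -> : Normc.normc z = Num.sqrt (complex.Re z ^+ 2 + complex.Im z ^+ 2).
  by case: (z).
suff cs : (complex.Re z + k.+1%:R^-1 * complex.Re w) ^+ 2 +
    (complex.Im z + k.+1%:R^-1 * complex.Im w) ^+ 2 @[k --> \oo] -->
    complex.Re z ^+ 2 + complex.Im z ^+ 2.
  exact: (continuous_cvg _ (@sqrt_continuous R _) cs).
by apply: cvgD; exact: cvgM.
Qed.

End pairing.

(** * Infinite sets of reals and real zeros of polynomials *)

(** Three points of [A], sorted, suffice. For the support of a measure on an interval, the outer two
    keep a neighbourhood of the middle one inside that interval. *)
Lemma infinite_set_between (R : realType) (A : set R) : infinite_set A ->
  exists a x b, [/\ A a, A x, A b & a < x < b].
Proof.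
move=> /(infinite_set_fset 3)[B BA].
have : sorted <%O (sort <=%O (finmap.enum_fset B)).
  by rewrite sort_lt_sorted finmap.fset_uniq.
rewrite -(size_sort <=%O (finmap.enum_fset B)).
have : forall y, y \in sort <=%O (finmap.enum_fset B) -> A y.
  by move=> y; rewrite mem_sort => yB; exact: BA.
case: sort => [//|a [//|x [//|b s]]] sA /= /and3P[ax xb _] _.
by exists a, x, b; split; rewrite ?ax// ; apply: sA; rewrite !inE eqxx ?orbT.
Qed.

Lemma finite_real_roots (R : realType) (q : {poly R[i]}) : q != 0 ->
  finite_set [set x : R | root q x%:C].
Proof.
move=> q0; apply: contrapT => /(infinite_set_fset (size q))[B Bq].
apply/negP; rewrite -ltnNge.
rewrite -(size_map (real_complex R)); apply: max_poly_roots => //.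
  by apply/allP => _ /mapP[x xB ->]; exact: Bq.
by rewrite map_inj_uniq ?finmap.fset_uniq//; exact: complexI.
Qed.

(** * Convexity and differentiation of the energy for a single measure *)

Section polynomial_energy.
Variables (R : realType) (p : R).
Variables (mu : {measure set (measurableTypeR R) -> \bar R}) (D : set R).
Hypothesis p1 : 1 < p.
Hypothesis mD : measurable (D : set (measurableTypeR R)).
Hypothesis muLp : forall q : {poly R[i]}, complex_Lp mu p (fun x => q.[x%:C]).
Implicit Types f q : {poly R[i]}.

Let p0 : 0 < p. Proof. exact: lt_trans p1. Qed.

(** Taken real-valued so that energies can be subtracted; [integrable_normc_powR] rules out the
    default value of [Rintegral]. *)
Definition energy q : R := \int[mu]_(x in D) (Normc.normc q.[x%:C] `^ p).

Definition energy_pairing f q : R :=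
  \int[mu]_(x in D) powR_pairing p f.[x%:C] q.[x%:C].

Lemma measurable_dotc f q :
  measurable_fun [set: measurableTypeR R] (fun x => dotc f.[x%:C] q.[x%:C]).
Proof.
have [fR fI _] := muLp f; have [qR qI _] := muLp q.
by apply: measurable_funD; exact: measurable_funM.
Qed.

Lemma measurable_normc q :
  measurable_fun [set: measurableTypeR R] (fun x => Normc.normc q.[x%:C]).
Proof.
(* The modulus is written as a square root of [dotc], whose measurability comes from the real and
   imaginary parts. *)
rewrite (_ : (fun _ => _) = fun x : R => dotc q.[x%:C] q.[x%:C] `^ 2^-1); last first.
  apply/funext => x; rewrite -sqr_normc powR12_sqrt ?sqr_ge0// sqrtr_sqr.
  by rewrite ger0_norm ?normc_ge0.
apply: (measurableT_comp (measurable_powR _)).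
exact: measurable_dotc.
Qed.

Lemma measurable_normc_powR q r :
  measurable_fun [set: measurableTypeR R] (fun x => Normc.normc q.[x%:C] `^ r).
Proof. exact: (measurableT_comp (measurable_powR _)) (measurable_normc q). Qed.

Lemma measurable_powR_pairing f q :
  measurable_fun [set: measurableTypeR R]
    (fun x => powR_pairing p f.[x%:C] q.[x%:C]).
Proof.
apply: measurable_funM; first exact: measurable_dotc.
exact: measurable_normc_powR.
Qed.

Lemma integrable_normc_powR q :
  mu.-integrable D (EFin \o (fun x => Normc.normc q.[x%:C] `^ p)).
Proof.
apply: (@integrableS _ _ _ _ setT) => //.
apply/integrableP; split.
  by apply/measurable_EFinP; exact: measurable_normc_powR.
have [_ _ fin] := muLp q.
under eq_integral do rewrite /= ger0_norm ?powR_ge0//.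
have pn0 : p != 0 by rewrite gt_eqF.
have := poweR_Lnorm mu (EFin \o (fun x => Normc.normc q.[x%:C])) pn0.
under eq_integral do rewrite /= ger0_norm ?normc_ge0//.
by move=> <-; exact: poweR_lty.
Qed.

Lemma integrable_powR_pairing f q :
  mu.-integrable D (EFin \o (fun x => powR_pairing p f.[x%:C] q.[x%:C])).
Proof.
apply: (le_integrable mD _ _ (integrableD mD (integrable_normc_powR f)
    (integrable_normc_powR q))).
  by apply/measurable_EFinP/measurable_funTS; exact: measurable_powR_pairing.
move=> x _ /=; rewrite lee_fin [leRHS]ger0_norm ?addr_ge0 ?powR_ge0//.
exact: powR_pairing_bound.
Qed.

Lemma energy_pairingZ f q (a : R) :
  energy_pairing f (a%:C *: q) = a * energy_pairing f q.
Proof.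
rewrite -RintegralZl//; last exact: integrable_powR_pairing.
apply: eq_Rintegral => x _; rewrite hornerZ /powR_pairing mulrA.
congr (_ * _); rewrite /dotc.
by case: f.[_] q.[_] => [b c] [d e]; simpc => /=; ring.
Qed.

Lemma energy_convex f q :
  energy f + p * energy_pairing f (q - f) <= energy q.
Proof.
have I := integrable_powR_pairing f (q - f).
have pI : mu.-integrable D
  (EFin \o (fun x => p * powR_pairing p f.[x%:C] (q - f).[x%:C])).
  have := integrableZl mD p I.
  by apply: eq_integrable.
rewrite -RintegralZl// -RintegralD//; last exact: integrable_normc_powR.
apply: le_Rintegral => //; last 2 first.
- exact: integrable_normc_powR.
- move=> x _; rewrite hornerD hornerN; exact: powR_normc_convex.
have := integrableD mD (integrable_normc_powR f) pI.
by apply: eq_integrable.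
Qed.

(** The convexity gap [h] is nonnegative with integral at most 0, hence zero almost everywhere on
    [D]. By strict convexity it is positive wherever [f] and [q] differ, which for distinct
    polynomials includes an open set [U] around a support point. *)
Lemma energy_convex_eq f q : infinite_set (measure_support mu) ->
    measure_support mu `<=` D -> is_interval D ->
  energy q <= energy f + p * energy_pairing f (q - f) -> f = q.
Proof.
move=> inf supD iD; rewrite /energy /energy_pairing.
have I := integrable_powR_pairing f (q - f).
set h := fun x : R => Normc.normc q.[x%:C] `^ p -
  (Normc.normc f.[x%:C] `^ p + p * powR_pairing p f.[x%:C] (q - f).[x%:C]).
have hq := integrable_normc_powR q.
have pI : mu.-integrable D
  (EFin \o (fun x => p * powR_pairing p f.[x%:C] (q - f).[x%:C])).
  by have := integrableZl mD p I; apply: eq_integrable.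
have hf : mu.-integrable D (EFin \o (fun x => Normc.normc f.[x%:C] `^ p +
    p * powR_pairing p f.[x%:C] (q - f).[x%:C])).
  have := integrableD mD (integrable_normc_powR f) pI.
  by apply: eq_integrable.
rewrite -RintegralZl// -RintegralD//; last exact: integrable_normc_powR.
rewrite -subr_le0 -RintegralB// => h_le0.
have hI : mu.-integrable D (EFin \o h).
  by have := integrableB mD hq hf; apply: eq_integrable.
have h_ge0 x : 0 <= h x.
  by rewrite subr_ge0 hornerD hornerN; exact: powR_normc_convex.
have : (\int[mu]_(x in D) `|(EFin \o h) x| = 0)%E.
  under eq_integral do rewrite /= ger0_norm//.
  rewrite -[LHS]fineK; last exact: integrable_fin_num.
  by congr EFin; apply/eqP; rewrite eq_le h_le0 Rintegral_ge0.
move/(ae_eq_integral_abs _ mD (measurable_int _ hI)) => -[N [mN muN0 DN]].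
apply/eqP; rewrite -subr_eq0 -oppr_eq0 opprB; apply/negPn/negP => qf.
have fin := finite_real_roots qf.
(* The middle point avoids the zeros of [q - f], and [a] and [b] lie in [D], so the whole interval
   between them does. *)
have [a [x [b [[sa _] [sx dx] [sb _] /andP[ax xb]]]]] :=
  infinite_set_between (infinite_setD inf fin).
set U := `]a, b[%classic `\` [set x : R | root (q - f) x%:C].
have oU : open U.
  apply: openI; first exact: interval_open.
  apply: closed_openC; apply: compact_closed (finite_compact fin).
  exact: Rhausdorff.
have Ux : U x by split=> //=; rewrite in_itv/= ax xb.
(* [U] lies in the null set [N], although the support point [x] gives it positive measure. *)
have := sx _ oU Ux; apply/negP; rewrite -leNgt -muN0.
apply: le_measure; rewrite ?inE//; first exact: open_measurable.
move=> y [/=]; rewrite in_itv/= => /andP[ay yb] ry; apply: DN => /= hy.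
have Dy : D y by apply: (iD a b); rewrite ?ltW//; exact: supD.
have [] := hy Dy => /eqP; rewrite subr_eq0 => /eqP heq.
apply: ry; rewrite /root hornerD hornerN subr_eq0.
have [//|/powR_normc_convex_lt] := eqVneq f.[y%:C] q.[y%:C].
by move=> /(_ _ p1); rewrite heq hornerD hornerN ltxx.
Qed.

Lemma cvg_energy_pairing f q :
  energy_pairing (f + (k.+1%:R^-1)%:C *: q) q @[k --> \oo] -->
  energy_pairing f q.
Proof.
have mt k := measurable_powR_pairing (f + (k.+1%:R^-1)%:C *: q) q.
have [] := @dominated_convergence _ _ _ mu D mD
  (fun k x => (powR_pairing p (f + (k.+1%:R^-1)%:C *: q).[x%:C] q.[x%:C])%:E)
  (fun x => (powR_pairing p f.[x%:C] q.[x%:C])%:E)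
  (* Majorant from [powR_pairing_bound], the estimate |f + tq| <= |f| + |q| for 0 < t <= 1, and
     [powR_add_le]. *)
  (fun x => (2 `^ p * (Normc.normc f.[x%:C] `^ p + Normc.normc q.[x%:C] `^ p)
     + Normc.normc q.[x%:C] `^ p)%:E).
- by move=> k; apply/measurable_EFinP/measurable_funTS.
- by apply/measurable_EFinP/measurable_funTS; exact: measurable_powR_pairing.
- apply: aeW => x _; apply: cvg_EFin; first exact: nearW.
  under eq_fun do rewrite /= hornerD hornerZ.
  exact: cvg_powR_pairing.
- have If := integrable_normc_powR f; have Iq := integrable_normc_powR q.
  have := integrableD mD (integrableZl mD (2 `^ p) (integrableD mD If Iq)) Iq.
  by apply: eq_integrable.
- apply: aeW => x k _; rewrite /= lee_fin.
  apply: le_trans (powR_pairing_bound p1 _ _) _; rewrite lerD2r.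
  apply: le_trans (powR_add_le (ltW p0) (normc_ge0 _) (normc_ge0 _)).
  apply: ge0_ler_powR; rewrite ?nnegrE ?addr_ge0 ?normc_ge0//; first exact: ltW.
  rewrite hornerD hornerZ; apply: le_trans (le_normcD _ _) _.
  rewrite lerD2l Normc.normcM ler_piMl ?normc_ge0//.
  by rewrite /= expr0n addr0 sqrtr_sqr ger0_norm// invf_le1// ler1n.
move=> _ _ cvI.
have fin := integrable_fin_num mD (integrable_powR_pairing f q).
by rewrite -[X in _ --> X](fineK fin) in cvI; exact: (fine_cvg cvI).
Qed.

(** The imaginary part reduces to the real one through Im u = - Re (iu). Conjugating coefficients
    conjugates values at real points, which matches the conjugate in [Re_csgn_pairing]. *)
Lemma cintegral_energy_pairing f q :
  cintegral mu D (fun x =>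
    q.[x%:C] * csgn f.[x%:C] * (Normc.normc f.[x%:C] `^ (p - 1))%:C) =
  energy_pairing f (map_poly conjc q) +i*
    - energy_pairing f (map_poly conjc ('i%C *: q)).
Proof.
have hc (r : {poly R[i]}) (x : R) : r.[x%:C] = conjc (map_poly conjc r).[x%:C].
  by rewrite -[in RHS](conjc_real x) horner_map conjcK.
congr Complex.
  by apply: eq_Rintegral => x _; rewrite hc Re_csgn_pairing.
rewrite /energy_pairing -[RHS]mulN1r -RintegralZl//; last exact: integrable_powR_pairing.
apply: eq_Rintegral => x _; rewrite -Re_csgn_pairing//. rewrite -hc hornerZ.
by clear; case: (csgn _) q.[_] => [a b] [c d]; simpc => /=; ring.
Qed.

End polynomial_energy.

(** * Monic polynomials as an affine space over lower degrees *)

Section monic_of_degree.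
Variables (R : realType) (n : nat).
Implicit Types L Q : {poly R[i]}.

Lemma monic_of_degreeD L Q : monic_of_degree n L -> (size Q <= n)%N ->
  monic_of_degree n (L + Q).
Proof.
move=> [mL sL] sQ; have lQ : (size Q < size L)%N by rewrite sL ltnS.
split; first by rewrite monicE lead_coefDl// -monicE.
by rewrite size_polyDl.
Qed.

Lemma size_monic_of_degreeB L Q : monic_of_degree n L -> monic_of_degree n Q ->
  (size (Q - L)%R <= n)%N.
Proof.
move=> [/monicP + sL] [/monicP + sQ]; rewrite /lead_coef sL sQ /= => L1 Q1.
apply/leq_sizeP => j; rewrite leq_eqVlt coefB => /predU1P[<-|nj].
  by rewrite L1 Q1 subrr.
by rewrite !nth_default ?subrr ?sL ?sQ.
Qed.

End monic_of_degree.

(** * The Sobolev energy: convexity, equality case and orthogonality *)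

Section sobolev.
Variables (R : realType) (p : R).
Variables (mu0 mu1 : {measure set (measurableTypeR R) -> \bar R}).
Variables (D0 D1 : set R).
Hypothesis p1 : 1 < p.
Hypothesis mD0 : measurable (D0 : set (measurableTypeR R)).
Hypothesis mD1 : measurable (D1 : set (measurableTypeR R)).
Hypothesis Lp0 : forall q : {poly R[i]}, complex_Lp mu0 p (fun x => q.[x%:C]).
Hypothesis Lp1 : forall q : {poly R[i]}, complex_Lp mu1 p (fun x => q.[x%:C]).
Implicit Types f q : {poly R[i]}.

Let p0 : 0 < p. Proof. exact: lt_trans p1. Qed.

Definition sobolev_energy q : R := energy p mu0 D0 q + energy p mu1 D1 q^`().

Definition sobolev_pairing f q : R :=
  energy_pairing p mu0 D0 f q + energy_pairing p mu1 D1 f^`() q^`().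

(** Both integrals are finite and the power [p^-1] is strictly increasing, so minimizing the norm
    amounts to minimizing the real energy. *)
Lemma le_sobolev_norm f q :
  (sobolev_norm mu0 mu1 D0 D1 p f <= sobolev_norm mu0 mu1 D0 D1 p q)%E =
  (sobolev_energy f <= sobolev_energy q).
Proof.
have ge0 r : 0 <= sobolev_energy r.
  by rewrite addr_ge0// Rintegral_ge0// => x _; exact: powR_ge0.
have normE r : sobolev_norm mu0 mu1 D0 D1 p r = (sobolev_energy r `^ p^-1)%:E.
  rewrite -poweR_EFin EFinD /sobolev_norm; congr (_ `^ _)%E; congr (_ + _)%E.
    by rewrite [RHS]fineK//; exact/integrable_fin_num/integrable_normc_powR.
  by rewrite [RHS]fineK//; exact/integrable_fin_num/integrable_normc_powR.
have pV0 : 0 < p^-1 by rewrite invr_gt0.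
rewrite !normE lee_fin; case: (leP (sobolev_energy f)) => [fq|qf].
  exact: ge0_ler_powR (ltW pV0) _ _ (ge0 f) (ge0 q) fq.
by apply/negbTE; rewrite -ltNge; exact: gt0_ltr_powR pV0 _ _ (ge0 q) (ge0 f) qf.
Qed.

Lemma sobolev_pairingZ f q (a : R) :
  sobolev_pairing f (a%:C *: q) = a * sobolev_pairing f q.
Proof. by rewrite /sobolev_pairing derivZ !energy_pairingZ// mulrDr. Qed.

Lemma sobolev_convex f q :
  sobolev_energy f + p * sobolev_pairing f (q - f) <= sobolev_energy q.
Proof.
rewrite /sobolev_energy /sobolev_pairing derivB mulrDr addrACA.
by apply: lerD; exact: energy_convex.
Qed.

(** Subtracting the convexity inequality for the derivatives under [mu1] leaves the equality case
    for [mu0] alone. *)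
Lemma sobolev_convex_eq f q : infinite_set (measure_support mu0) ->
    measure_support mu0 `<=` D0 -> is_interval D0 ->
  sobolev_energy q <= sobolev_energy f + p * sobolev_pairing f (q - f) -> f = q.
Proof.
move=> inf supD iD h; apply: (energy_convex_eq p1 mD0 Lp0 inf supD iD).
move: h; rewrite /sobolev_energy /sobolev_pairing derivB mulrDr addrACA => h.
rewrite -(lerD2r (energy p mu1 D1 q^`())); apply: le_trans h _.
by rewrite lerD2l; exact: energy_convex.
Qed.

Lemma cvg_sobolev_pairing f q :
  sobolev_pairing (f + (k.+1%:R^-1)%:C *: q) q @[k --> \oo] -->
  sobolev_pairing f q.
Proof.
apply: cvgD; first exact: cvg_energy_pairing.
under eq_fun do rewrite derivD derivZ.
exact: cvg_energy_pairing.
Qed.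

Lemma cintegral_sobolev_pairing f q :
  cintegral mu0 D0 (fun x =>
    q.[x%:C] * csgn f.[x%:C] * (Normc.normc f.[x%:C] `^ (p - 1))%:C)
  + cintegral mu1 D1 (fun x =>
      (q^`()).[x%:C] * csgn (f^`()).[x%:C]
      * (Normc.normc (f^`()).[x%:C] `^ (p - 1))%:C) =
  sobolev_pairing f (map_poly conjc q) +i*
    - sobolev_pairing f (map_poly conjc ('i%C *: q)).
Proof.
rewrite !cintegral_energy_pairing// /sobolev_pairing !deriv_map derivZ.
by rewrite opprD; simpc.
Qed.

(** Polynomials of size at most [n] are stable under conjugation of coefficients and multiplication
    by i, so vanishing of the real pairing on all of them captures both parts of the complex
    condition. *)
Lemma sobolev_orthogonalP f n :
  (forall q, (size q <= n)%N ->
    cintegral mu0 D0 (fun x =>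
      q.[x%:C] * csgn f.[x%:C] * (Normc.normc f.[x%:C] `^ (p - 1))%:C)
    + cintegral mu1 D1 (fun x =>
        (q^`()).[x%:C] * csgn (f^`()).[x%:C]
        * (Normc.normc (f^`()).[x%:C] `^ (p - 1))%:C) = 0) <->
  (forall q, (size q <= n)%N -> sobolev_pairing f q = 0).
Proof.
have size_conj (r : {poly R[i]}) : size (map_poly conjc r) = size r.
  by apply: size_map_inj_poly; [exact: (can_inj (@conjcK R)) | exact: rmorph0].
split=> h q sq.
  have := h (map_poly conjc q); rewrite size_conj cintegral_sobolev_pairing.
  rewrite -map_poly_comp map_poly_id; last by move=> x _ /=; rewrite conjcK.
  by move=> /(_ sq)[].
rewrite cintegral_sobolev_pairing !h ?oppr0 ?size_conj//.
exact: leq_trans (size_scale_leq _ _) sq.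
Qed.

Lemma minimizer_sobolev_pairing_ge0 f q n :
    is_monic_minimizer (sobolev_norm mu0 mu1 D0 D1 p) n f -> (size q <= n)%N ->
  0 <= sobolev_pairing f q.
Proof.
move=> [mf fmin] sq; apply: (cvgr_to_ge (@cvg_sobolev_pairing f q)).
apply: nearW => k; set t : R := k.+1%:R^-1.
have t0 : 0 < t by rewrite invr_gt0.
have := fmin (f + t%:C *: q); rewrite le_sobolev_norm.
move=> /(_ (monic_of_degreeD mf (leq_trans (size_scale_leq _ _) sq))).
(* The displacement back to [f] is -tq; minimality of [f] then makes t times the pairing at the
   perturbed point nonnegative. *)
have := sobolev_convex (f + t%:C *: q) f.
rewrite opprD addrA subrr add0r -scaleNr -rmorphN sobolev_pairingZ => h1 h2.
have := le_trans h1 h2.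
by rewrite gerDl mulNr mulrN oppr_le0 mulrA pmulr_rge0// mulr_gt0.
Qed.

End sobolev.

Theorem theorem2 (R : realType) (p : R)
    (mu0 mu1 : {measure set (measurableTypeR R) -> \bar R})
    (D0 D1 : set R) (n : nat) (L : {poly R[i]})
    (hp : 1 < p)
    (hD0 : is_interval D0) (hD1 : is_interval D1)
    (hD0_pt : ~ exists a : R, D0 = [set a])
    (hsupp0 : measure_support mu0 `<=` D0)
    (hsupp1 : measure_support mu1 `<=` D1)
    (hinf : infinite_set (measure_support mu0))
    (hLp0 : forall q : {poly R[i]}, complex_Lp mu0 p (fun x => q.[x%:C]))
    (hLp1 : forall q : {poly R[i]}, complex_Lp mu1 p (fun x => q.[x%:C]))
    (hL : monic_of_degree n L) :
  is_monic_extremal (sobolev_norm mu0 mu1 D0 D1 p) n L <->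
  forall Q : {poly R[i]}, (size Q <= n)%N ->
    cintegral mu0 D0 (fun x =>
      Q.[x%:C] * csgn L.[x%:C] * (Normc.normc L.[x%:C] `^ (p - 1))%:C)
    + cintegral mu1 D1 (fun x =>
        (Q^`()).[x%:C] * csgn (L^`()).[x%:C]
        * (Normc.normc (L^`()).[x%:C] `^ (p - 1))%:C)
    = 0.
Proof.
have mD0 := is_interval_measurable hD0; have mD1 := is_interval_measurable hD1.
have leN := le_sobolev_norm hp mD0 mD1 hLp0 hLp1.
have orth := sobolev_orthogonalP hp mD0 mD1 hLp0 hLp1 L n.
apply: iff_trans (iff_sym orth); split.
  move=> [Lmin _] Q sQ; apply/eqP; rewrite eq_le.
  have S_ge0 := minimizer_sobolev_pairing_ge0 hp mD0 mD1 hLp0 hLp1 Lmin.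
  apply/andP; split; last exact: S_ge0.
  (* The opposite sign comes from testing against -Q. *)
  rewrite -oppr_ge0 -mulN1r -(sobolev_pairingZ hp mD0 mD1 hLp0 hLp1).
  exact/S_ge0/(leq_trans (size_scale_leq _ _)).
move=> S0.
(* Competitors differ from [L] in degree below [n], so orthogonality removes the linear term of the
   tangent inequality. *)
have SB Q : monic_of_degree n Q ->
    sobolev_energy p mu0 mu1 D0 D1 L +
      p * sobolev_pairing p mu0 mu1 D0 D1 L (Q - L) =
    sobolev_energy p mu0 mu1 D0 D1 L.
  by move=> /(size_monic_of_degreeB hL)/S0 ->; rewrite mulr0 addr0.
split; [split=> [|Q mQ]|move=> Q [mQ Qmin]]; first exact: hL.
  rewrite leN -(SB _ mQ); exact: sobolev_convex.
(* Another minimizer has energy at most that of [L], which is the equality case of convexity. *)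
apply: (sobolev_convex_eq hp mD0 mD1 hLp0 hLp1 hinf hsupp0 hD0).
rewrite (SB _ mQ) -leN; exact: Qmin.
Qed.
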